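(* Let $n>1$ be a fixed integer. Let $\mathfrak X$ be a real and separable Fréchet space, and let $\sigma:\mathfrak X\to\mathfrak X$ be continuous, von Neumann-bounded, and satisfy the following condition: there exist $\psi\in\mathfrak X'\setminus\{0\}$ and $0\ne u_+\in\mathfrak X$ such that $$\lim_{\lambda\to\infty}\sigma(\lambda x)=u_+\ \text{if }x\in\Psi_+,\qquad \lim_{\lambda\to\infty}\sigma(\lambda x)=0\ \text{if }x\in\Psi_-,\qquad \lim_{\lambda\to\infty}\sigma(\lambda x)=0\ \text{if }x\in\Psi_0,$$ where $\Psi_+=\{x\in\mathfrak X:\langle\psi,x\rangle>0\}$, $\Psi_-=\{x\in\mathfrak X:\langle\psi,x\rangle<0\}$ and $\Psi_0=\ker(\psi)$. Then the set $\mathfrak N(\sigma)$ of linear combinations of $n$-layer neural networks with activation function $\sigma$ is dense in $C(\mathfrak X;\mathbb R)$ with respect to the topology of compact subsets of $\mathfrak X$.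
   Context: The topology of $\mathfrak X$ is generated by an increasing sequence of seminorms $(p_k)_{k\in\mathbb N}$. $\mathfrak X'$ is the topological dual of $\mathfrak X$, $\langle\cdot,\cdot\rangle$ the canonical pairing between $\mathfrak X'$ and $\mathfrak X$, $\mathcal L(\mathfrak X)$ the space of continuous linear operators $\mathfrak X\to\mathfrak X$, and $C(\mathfrak X;\mathbb R)$ the space of continuous real-valued functions on $\mathfrak X$. The topology of compact subsets on $C(\mathfrak X;\mathbb R)$ is the locally convex topology generated by the seminorms $q_K(f)=\sup_{x\in K}|f(x)|$, $K\subset\mathfrak X$ compact. $\sigma$ is von Neumann-bounded if for every $k\in\mathbb N$ there is $c_k>0$ with $\sup_{x\in\mathfrak X}p_k(\sigma(x))\le c_k$. For $\ell\in\mathfrak X'$, $A_1,\dots,A_n\in\mathcal L(\mathfrak X)$, $b_1,\dots,b_n\in\mathfrak X$, put $T_j(x)=A_jx+b_j$ for $j=1,\dots,n$. The $n$-layer neural network is $$\mathcal N_{\ell,A_1,b_1,\dots,A_n,b_n}(x)=\langle\ell,(\sigma\circ T_1\circ\cdots\circ\sigma\circ T_n)(x)\rangle,\quad x\in\mathfrak X,$$ and $\mathfrak N(\sigma)=\operatorname{span}\{\mathcal N_{\ell,A_1,b_1,\dots,A_n,b_n}:\ \ell\in\mathfrak X',\ A_1,\dots,A_n\in\mathcal L(\mathfrak X),\ b_1,\dots,b_n\in\mathfrak X\}$. *)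

(* Defs.v *)
From HB Require Import structures.
From mathcomp Require Import all_boot all_order all_algebra.
From mathcomp Require Import all_classical all_reals all_analysis.

Set Implicit Arguments.
Unset Strict Implicit.
Unset Printing Implicit Defensive.

Import Order.TTheory GRing.Theory Num.Theory.
Import numFieldNormedType.Exports.

Local Open Scope classical_set_scope.
Local Open Scope ring_scope.

Section Frechet.
Context (R : realType) (X : topologicalLmodType R).

Definition seminorm (p : X -> R) : Prop :=
  (forall x y, p (x + y) <= p x + p y) /\
  (forall (a : R) x, p (a *: x) = `|a| * p x).

Definition generated_by (p : nat -> X -> R) : Prop :=
  forall (x : X) (A : set X), nbhs x A <->
    exists (n : nat) (e : R), 0 < e /\
      [set y | forall k, (k <= n)%N -> p k (y - x) < e] `<=` A.

(* The entourages of a [tvsType] are only required to induce its topology, not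
   to be translation invariant, so the library's [cauchy] may differ from the
   Cauchy property of the topological vector space used here. *)
Definition cauchy_sequence (u : nat -> X) : Prop :=
  forall U : set X, nbhs 0 U ->
    exists N : nat, forall i j : nat, (N <= i)%N -> (N <= j)%N -> U (u i - u j).

(* Sequential completeness suffices: the topology is first countable. *)
Record frechet (p : nat -> X -> R) : Prop := Frechet {
  frechet_seminorm : forall k, seminorm (p k);
  frechet_increasing : forall k x, p k x <= p k.+1 x;
  frechet_topology : generated_by p;
  frechet_hausdorff : hausdorff_space X;
  frechet_complete : forall u : nat -> X, cauchy_sequence u ->
    exists l : X, u @ \oo --> l }.

Definition separable : Prop := exists D : set X, countable D /\ dense D.

Definition von_neumann_bounded (p : nat -> X -> R) (sigma : X -> X) : Prop :=
  forall k, exists c : R, 0 < c /\ forall x, p k (sigma x) <= c.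

End Frechet.

Section NeuralNetworks.
Context (R : realType) (X : topologicalLmodType R).

Definition affine (A : X -> X) (b : X) : X -> X := fun x => A x + b.

(* The iterated operator unfolds to a right fold, so the layer of index 0 is
   the outermost one. *)
Definition network (n : nat) (sigma : X -> X) (l : X -> R^o)
    (A : 'I_n -> X -> X) (b : 'I_n -> X) : X -> R^o :=
  fun x => l ((\big[@comp X X X/idfun]_(j < n) (sigma \o affine (A j) (b j))) x).

Definition networks (n : nat) (sigma : X -> X) : set (X -> R^o) :=
  [set f | exists (l : {linear X -> R^o}) (A : 'I_n -> {linear X -> X})
                  (b : 'I_n -> X),
     [/\ continuous l, forall j, continuous (A j)
       & f = network sigma l A b] ].

Definition lin_span (V : lmodType R) (S : set V) : set V :=
  [set v | exists (m : nat) (c : 'I_m -> R) (s : 'I_m -> V),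
     (forall i, S (s i)) /\ v = \sum_(i < m) c i *: s i].

Definition continuous_compact_topology : topologicalType :=
  initial_topology (fun f : continuousType X R^o =>
    (f : X -> R^o) : {family compact, X -> R^o}).

(* For continuous [sigma] every network is continuous, so this is the whole
   span. *)
Definition network_span (n : nat) (sigma : X -> X) :
    set continuous_compact_topology :=
  [set f : continuousType X R^o |
     lin_span (networks n sigma) (f : X -> R^o)].

End NeuralNetworks.

(* Main.v *)
(* Hahn-Banach gives l in the dual with l u = 1 that is bounded on the range of
   sigma.  For psi v > 0, g(s) = l (sigma (s v)) is then a bounded function with
   limits 1 and 0 at +oo and -oo, so on a compact set sums of g(a f + b)
   approximate h(f) uniformly for every locally Lipschitz h.  If f is an n-layer
   network, g(a f + b) is an (n+1)-layer one, whose outer affine map has rank one.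
   With f a continuous functional and h = exp, the one-layer networks approximate
   the span of the functions exp(f), an algebra to which Stone-Weierstrass applies.
   With h the identity, (n+1)-layer networks approximate n-layer ones, and density
   propagates to every depth. *)
Require Import Defs.
From HB Require Import structures.
From mathcomp Require Import all_boot all_order all_algebra.
From mathcomp Require Import all_classical all_reals all_analysis.
From mathcomp Require Import ring lra.

Set Implicit Arguments.
Unset Strict Implicit.
Unset Printing Implicit Defensive.

Import Order.TTheory GRing.Theory Num.Theory.
Import numFieldNormedType.Exports.

Local Open Scope classical_set_scope.
Local Open Scope ring_scope.

(** * Compactness as an induction principle *)

Lemma compact_ind (T : topologicalType) (K : set T) (P : set T -> Prop) :
  compact K -> P set0 ->
  (forall A B, A `<=` B -> P B -> P A) ->
  (forall A B, P A -> P B -> P (A `|` B)) ->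
  (forall x, K x -> exists2 U, nbhs x U & P U) -> P K.
Proof.
move=> cK P0 PS PU Ploc; apply: contrapT => nPK.
(* Sets whose complement in [K] satisfies [P] form a filter, proper because [P K] fails; the local
   hypothesis at one of its cluster points gives a contradiction. *)
pose F : set_system T := [set A | P (K `\` A)].
have FF : ProperFilter F.
  split; first by rewrite /F /= setD0.
  split.
  - by rewrite /F /= setDT.
  - by move=> A B FA FB; rewrite /F /= setDIr; exact: PU.
  - by move=> A B AB; apply: PS => x [Kx nB]; split => // /AB.
have [|x [Kx clx]] := cK F FF; first by rewrite /F /= setDv.
have [U xU PU'] := Ploc x Kx.
have [|y [nUy Uy]] := clx (~` U) U _ xU; last exact: nUy.
by apply: PS PU' => z [_ /contrapT].
Qed.

(** * Uniform approximation on a set *)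

Section Approximation.
Context (R : realType) (T : Type).
Implicit Types (S : set (T -> R^o)) (K : set T) (f g : T -> R^o).

Definition approximable S K f :=
  forall e : R, 0 < e -> exists2 g, S g & forall x, K x -> `|f x - g x| < e.

Definition linear_subspace S :=
  forall (a b : R) f g, S f -> S g -> S (fun x => a * f x + b * g x).

Lemma approximable_id S K f : S f -> approximable S K f.
Proof. by move=> Sf e e0; exists f => // x _; rewrite subrr normr0. Qed.

Lemma approximable_trans S S' K f :
  (forall g, S g -> approximable S' K g) ->
  approximable S K f -> approximable S' K f.
Proof.
move=> SS' Sf e e0; have e2 : 0 < e / 2 by rewrite divr_gt0.
have [g Sg fg] := Sf _ e2; have [h Sh gh] := SS' g Sg _ e2.
exists h => // x Kx; have := fg x Kx; have := gh x Kx.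
by rewrite !ltr_norml; lra.
Qed.

Lemma approximable_linear S K :
  linear_subspace S -> linear_subspace (approximable S K).
Proof.
move=> linS a b f g Sf Sg e e0.
(* The summand 1 keeps the divisor positive when [a] and [b] are both zero. *)
have c0 : 0 < `|a| + `|b| + 1 by rewrite ltr_wpDl// addr_ge0.
have [f' Sf' ff'] := Sf _ (divr_gt0 e0 c0).
have [g' Sg' gg'] := Sg _ (divr_gt0 e0 c0).
exists (fun x => a * f' x + b * g' x) => [|x Kx]; first exact: linS.
have -> : a * f x + b * g x - (a * f' x + b * g' x) =
  a * (f x - f' x) + b * (g x - g' x) by ring.
apply: (@le_lt_trans _ _ ((`|a| + `|b|) * (e / (`|a| + `|b| + 1)))).
  rewrite (le_trans (ler_normD _ _))// !normrM mulrDl lerD// ler_wpM2l//.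
  - exact/ltW/ff'.
  - exact/ltW/gg'.
by rewrite mulrA ltr_pdivrMr// mulrC ltr_pM2l// ltrDl.
Qed.

End Approximation.

(** * The Stone-Weierstrass theorem *)

Section StoneWeierstrass.
Context (R : realType).

(* Newton-type iteration for [`|t|], converging uniformly on [-1, 1]. *)
Fixpoint abs_poly (n : nat) (t : R) : R :=
  if n is m.+1 then abs_poly m t + (t ^+ 2 - abs_poly m t ^+ 2) / 2 else 0.

(** Each iteration multiplies the error [|t| - q] by [1 - (|t| + q) / 2], which keeps [q] between 0
    and [|t|]. The last bound encodes an error of at most [2|t| / (2 + n|t|)], a rate of [2 / n]
    uniform in [t]. *)
Lemma abs_poly_bounds (n : nat) (t : R) : `|t| <= 1 ->
  [/\ 0 <= abs_poly n t, abs_poly n t <= `|t|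
    & (`|t| - abs_poly n t) * (2 + n%:R * `|t|) <= 2 * `|t|].
Proof.
move=> t1; have t0 := normr_ge0 t.
elim: n => [|n [q0 qt IH]] /=; first by split=> //; lra.
rewrite -(real_normK (num_real t)) -[n.+1%:R]natr1.
move: (abs_poly n t) q0 qt IH => q q0 qt IH.
have n0 : 0 <= n%:R :> R by [].
move: (`|t| : R) (n%:R : R) t0 n0 t1 q0 qt IH => a m a0 m0 a1 q0 qa IH.
have a2q2 : q ^+ 2 <= a ^+ 2 by rewrite ler_sqr.
split; first lra.
  have -> : q + (a ^+ 2 - q ^+ 2) / 2 = a - (a - q) * (1 - (a + q) / 2) by field.
  by rewrite gerBl mulr_ge0//; lra.
have -> : a - (q + (a ^+ 2 - q ^+ 2) / 2) = (a - q) * (1 - (a + q) / 2) by field.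
(* Without the factor [a - q], the claim is [(1 - (a + q) / 2) * (2 + (m + 1) * a) <= 2 + m * a];
   the gap is half the sum of the two nonnegative terms below. *)
apply: le_trans IH; rewrite -mulrA ler_wpM2l ?subr_ge0//.
have : 0 <= q * (2 + (m + 1) * a)
  by rewrite mulr_ge0// addr_ge0// mulr_ge0// addr_ge0.
have : 0 <= (m + 1) * (a * a) by rewrite mulr_ge0 ?addr_ge0 ?mulr_ge0.
lra.
Qed.

Lemma abs_poly_cvg (e : R) : 0 < e ->
  exists n, forall t, `|t| <= 1 -> `| `|t| - abs_poly n t| < e.
Proof.
move=> e0; exists (Num.bound (2 / e)) => t t1.
set n := Num.bound _.
have ne : 2 < n%:R * e.
  rewrite -ltr_pdivrMr//; apply: archi_boundP; exact/divr_ge0/ltW.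
have [q0 qt le2] := abs_poly_bounds n t1.
rewrite ger0_norm ?subr_ge0//.
have [t0|tn0] := eqVneq t 0; first by move: q0; rewrite t0 normr0; lra.
have tp : 0 < `|t| by rewrite normr_gt0.
have d0 : 0 <= `|t| - abs_poly n t by rewrite subr_ge0.
move: le2; rewrite mulrDr => le2.
(* Dropping twice the error from the bound and cancelling [|t|] leaves [n] times the error at most
   2. *)
have : (`|t| - abs_poly n t) * n%:R * `|t| <= 2 * `|t|.
  by move: le2; rewrite mulrA; lra.
rewrite ler_pM2r// => le3.
have n0 : 0 < n%:R :> R.
  rewrite ltr0n lt0n; apply: contraTneq ne => ->; rewrite mul0r; lra.
rewrite -(ltr_pM2r n0); lra.
Qed.

Variables (T : topologicalType) (K : set T).
Hypothesis compactK : compact K.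
Implicit Types (f g : T -> R^o).

Lemma compact_continuous_bounded f : continuous f ->
  exists2 M : R, 0 < M & forall x, K x -> `|f x| <= M.
Proof.
move=> cf; have /compact_bounded [M [Mr bM]] : compact (f @` K).
  apply: continuous_compact => //; exact: continuous_subspaceT.
exists (`|M| + 1) => [|x Kx]; first by rewrite ltr_wpDl.
by apply: (bM (`|M| + 1)); [rewrite (le_lt_trans (ler_norm M))// ltrDl|exists x].
Qed.

Variable A : set (T -> R^o).
Hypothesis A_continuous : forall f, A f -> continuous f.
Hypothesis A_linear : linear_subspace A.
Hypothesis A_mul : forall f g, A f -> A g -> A (fun x => f x * g x).
Hypothesis A_one : A (fun=> 1).
Hypothesis A_separates : forall x y, K x -> K y -> x <> y ->
  exists2 f, A f & f x <> f y.

(** Passing from [A] to its uniform closure on [K] gains stability under absolute values, hence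
    under maxima and minima. *)
Let W : set (T -> R^o) := [set f | continuous f /\ approximable A K f].

Let W_linear : linear_subspace W.
Proof.
move=> a b f g [cf Af] [cg Ag]; split; last exact: approximable_linear.
move=> x; apply: cvgD; apply: cvgM => //; try exact: cvg_cst; [exact: cf|exact: cg].
Qed.

Let W_sub f : A f -> W f.
Proof. by move=> Af; split; [exact: A_continuous|exact: approximable_id]. Qed.

Let W_cst c : W (fun=> c).
Proof.
have := W_linear c 0 (W_sub A_one) (W_sub A_one).
by congr W; apply/funext => x; rewrite mulr1 mul0r addr0.
Qed.

Let W_closed f : continuous f -> approximable W K f -> W f.
Proof. by move=> cf Wf; split=> //; apply: approximable_trans Wf => g []. Qed.

Let W_mul f g : W f -> W g -> W (fun x => f x * g x).
Proof.
move=> [cf Af] [cg Ag]; split; first by move=> x; apply: cvgM; [exact: cf|exact: cg].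
have [M M0 fM] := compact_continuous_bounded cf.
have [N N0 gN] := compact_continuous_bounded cg.
move=> e e0; have MN0 : 0 < M + N + 1 by lra.
(* With both errors below [d <= 1], the product is off by less than [d * (M + N + 1)]; the 1 pays
   for the product of the two errors. *)
pose d := Num.min 1 (e / (M + N + 1)).
have d0 : 0 < d by rewrite lt_min ltr01 divr_gt0.
have d1 : d <= 1 by rewrite ge_min lexx.
have dM : d * (M + N + 1) <= e by rewrite -ler_pdivlMr// ge_min lexx orbT.
have [f' Af' ff'] := Af _ d0; have [g' Ag' gg'] := Ag _ d0.
exists (fun x => f' x * g' x); first exact: A_mul.
move=> x Kx; apply: lt_le_trans dM.
have -> : f x * g x - f' x * g' x =
  f x * (g x - g' x) + g x * (f x - f' x) - (f x - f' x) * (g x - g' x) by ring.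
apply: (@le_lt_trans _ _ (M * `|g x - g' x| + N * `|f x - f' x|
    + `|f x - f' x| * 1)).
  rewrite (le_trans (ler_normB _ _))// lerD ?(le_trans (ler_normD _ _))//.
    by rewrite !normrM lerD// ler_wpM2r// ?fM ?gN.
  by rewrite normrM ler_wpM2l// (le_trans _ d1)// ltW// gg'.
rewrite !mulrDr mulr1 mulr1 (mulrC d M) (mulrC d N).
apply: ltr_leD; last exact/ltW/ff'.
by apply: ltrD; rewrite ltr_pM2l ?gg' ?ff'.
Qed.

(** Dividing by a bound [M] brings the values on [K] into [-1, 1], where the polynomials [abs_poly]
    converge uniformly to the absolute value. *)
Let W_abs f : W f -> W (fun x => `|f x|).
Proof.
move=> Wf; have cf := Wf.1.
have [M M0 fM] := compact_continuous_bounded cf.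
have Wp n : W (fun x => abs_poly n (M^-1 * f x)).
  have WM : W (fun x => M^-1 * f x).
    have := W_linear M^-1 0 Wf Wf.
    by congr W; apply/funext => x; rewrite mul0r addr0.
  elim: n => [|n IH] /=; first exact: W_cst.
  have := W_linear 1 1 IH (W_linear 2^-1 (- 2^-1) (W_mul WM WM) (W_mul IH IH)).
  congr W; apply/funext => x; rewrite !mul1r -!expr2; congr (_ + _).
  by rewrite mulrBl mulNr !(mulrC 2^-1).
apply: W_closed => [x|e e0].
  by apply: cvg_norm; exact: cf.
have [n Hn] := abs_poly_cvg (divr_gt0 e0 M0).
exists (fun x => M * abs_poly n (M^-1 * f x)).
  have := W_linear M 0 (Wp n) (Wp n).
  by congr W; apply/funext => x; rewrite mul0r addr0.
move=> x Kx.
have -> : `|f x| = M * `|M^-1 * f x|.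
  by rewrite normrM gtr0_norm ?invr_gt0// mulVKf// gt_eqF.
rewrite -mulrBr normrM gtr0_norm// mulrC -ltr_pdivlMr//; apply: Hn.
by rewrite normrM gtr0_norm ?invr_gt0// mulrC ler_pdivrMr// mul1r fM.
Qed.

Let W_max f g : W f -> W g -> W (fun x => Num.max (f x) (g x)).
Proof.
move=> Wf Wg.
have := W_linear 2^-1 2^-1 (W_linear 1 1 Wf Wg)
  (W_abs (W_linear 1 (-1) Wf Wg)).
congr W; apply/funext => x.
by rewrite maxr_absE !mul1r mulN1r mulrDl !(mulrC 2^-1).
Qed.

Let W_min f g : W f -> W g -> W (fun x => Num.min (f x) (g x)).
Proof.
move=> Wf Wg.
have := W_linear 2^-1 (- 2^-1) (W_linear 1 1 Wf Wg)
  (W_abs (W_linear 1 (-1) Wf Wg)).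
congr W; apply/funext => x.
by rewrite minr_absE !mul1r mulN1r mulrBl mulNr !(mulrC 2^-1).
Qed.

Let W_interpolate f x y : K x -> K y ->
  exists g, [/\ W g, g x = f x & g y = f y].
Proof.
move=> Kx Ky; have [<-|/eqP xy] := eqVneq x y; first by exists (fun=> f x).
have [s As sxy] := A_separates Kx Ky xy.
have d0 : s y - s x != 0 by apply/eqP => /eqP; rewrite subr_eq0 => /eqP/esym.
(* Slope of the affine function of [s] that agrees with [f] at both points. *)
pose k := (f y - f x) / (s y - s x).
exists (fun z => 1 * (f x) + k * (1 * s z + (- s x) * 1)); split.
- apply: W_linear; first exact: W_cst.
  by apply: W_linear; [exact: W_sub|exact: W_cst].
- by rewrite /k; ring.
- by rewrite /k; field.
Qed.

(** Lattice argument: maxima of two-point interpolants give functions above [f - e] on [K] that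
    equal [f] at a chosen point; minima of these also stay below [f + e]. [compact_ind] stands in
    for finite subcovers. *)
Lemma stone_weierstrass f : continuous f -> approximable A K f.
Proof.
move=> cf; suff : W f by case.
apply: W_closed => // e e0.
have near_lt (g h : T -> R^o) x : continuous g -> continuous h -> g x < h x ->
    \forall y \near x, g y < h y.
  move=> cg ch gh.
  have cgh : {for x, continuous (fun y => h y - g y)}.
    by apply: cvgB; [exact: ch|exact: cg].
  have : \forall y \near x, 0 < h y - g y.
    by apply: (cvgr_gt _ cgh); rewrite subr_gt0.
  by apply: filterS => y; rewrite subr_gt0.
have cfe c : continuous (fun y => f y + c).
  by move=> z; apply: cvgD; [exact: cf|exact: cvg_cst].
have below x : K x ->
    exists g, [/\ W g, g x = f x & forall y, K y -> f y - e < g y].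
  move=> Kx; apply: (@compact_ind _ K (fun B => exists g,
      [/\ W g, g x = f x & forall y, B y -> f y - e < g y])) => //.
  - by exists (fun=> f x).
  - move=> B C BC [g [Wg gx gC]]; exists g; split=> // y By.
    by apply: gC; exact: BC.
  - move=> B C [g [Wg gx gB]] [h [Wh hx hC]].
    exists (fun y => Num.max (g y) (h y)); split; first exact: W_max.
      by rewrite gx hx maxxx.
    move=> y [By|Cy]; rewrite lt_max; first by rewrite gB.
    by rewrite hC ?orbT.
  - move=> y Ky; have [g [Wg gx gy]] := W_interpolate f Kx Ky.
    exists [set z | f z - e < g z]; last by exists g.
    by apply: near_lt; [exact: cfe|exact: Wg.1|rewrite gy gtrBl].
(* The induction for minima starts from the function attached to some point of [K], so empty [K] is
   treated apart. *)
have [[x0 Kx0]|/forallNP K0] := pselect (exists x, K x); last first.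
  by exists (fun=> 0) => // x /K0.
suff [g [Wg g1 g2]] : exists g, [/\ W g, forall y, K y -> f y - e < g y
    & forall y, K y -> g y < f y + e].
  exists g => // x Kx; rewrite ltr_norml.
  by have := g1 x Kx; have := g2 x Kx; lra.
apply: (@compact_ind _ K (fun B => exists g, [/\ W g,
    forall y, K y -> f y - e < g y & forall y, B y -> g y < f y + e])) => //.
- by have [g [Wg _ gK]] := below x0 Kx0; exists g.
- move=> B C BC [g [Wg gx gC]]; exists g; split=> // y By.
  by apply: gC; exact: BC.
- move=> B C [g [Wg gK gB]] [h [Wh hK hC]].
  exists (fun y => Num.min (g y) (h y)); split; first exact: W_min.
    by move=> y Ky; rewrite lt_min gK// hK.
  move=> y [By|Cy]; rewrite gt_min; first by rewrite gB.
  by rewrite hC ?orbT.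
- move=> y Ky; have [g [Wg gy gK]] := below y Ky.
  exists [set z | g z < f z + e]; last by exists g.
  by apply: near_lt; [exact: Wg.1|exact: cfe|rewrite gy ltrDl].
Qed.

End StoneWeierstrass.

(** * Lipschitz functions as limits of sums of sigmoids *)

Lemma expR_lipschitz (R : realType) (M s t : R) : s <= M -> t <= M ->
  `|expR s - expR t| <= expR M * `|s - t|.
Proof.
have step a b : b <= a -> a <= M -> expR a - expR b <= expR M * (a - b).
  move=> ba aM.
  have -> : expR b = expR a * expR (b - a) by rewrite -expRD; congr expR; ring.
  (* The graph of the exponential lies above its tangent at [a]. *)
  have e1 : expR a * (1 + (b - a)) <= expR a * expR (b - a).
    by rewrite ler_wpM2l ?expR_ge0// expR_ge1Dx.
  have e2 : expR a * (a - b) <= expR M * (a - b).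
    by rewrite ler_wpM2r ?subr_ge0// ler_expR.
  lra.
move=> sM tM; have [st|/ltW st] := leP t s.
  by rewrite !ger0_norm ?subr_ge0 ?ler_expR// step.
by rewrite distrC [X in _ * X]distrC !ger0_norm ?subr_ge0 ?ler_expR// step.
Qed.

Section Sigmoid.
Context (R : realType) (T : Type) (S : set (T -> R^o)).
Context (phi : T -> R) (g : R -> R).
Variables (C L M : R) (h : R -> R).
Hypothesis S_linear : linear_subspace S.
Hypothesis S_ridge : forall a b, S (fun x => g (a * phi x + b)).
Hypothesis g_pinfty : g x @[x --> +oo] --> (1 : R).
Hypothesis g_ninfty : g (- x) @[x --> +oo] --> (0 : R).
Hypothesis g_bounded : forall x, `|g x| <= C.
Hypothesis h_lipschitz : forall s t, `|s| <= M -> `|t| <= M ->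
  `|h s - h t| <= L * `|s - t|.
Hypotheses (C_ge0 : 0 <= C) (L_ge0 : 0 <= L) (M_gt0 : 0 < M).

(** A common threshold for both tails lets a rescaled [g] pass from near 0 to near 1 within one grid
    cell. *)
Let g_step (e : R) : 0 < e -> exists2 t : R, 0 < t &
  forall x, t <= x -> `|g x - 1| <= e /\ `|g (- x)| <= e.
Proof.
move=> e0.
have /pinfty_ex_gt0[t t0 H] : \forall x \near +oo,
    forall y, x <= y -> `|1 - g y| < e /\ `|0 - g (- y)| < e.
  have /cvgrPdist_lt/(_ _ e0)[a [ar Ha]] := g_pinfty.
  have /cvgrPdist_lt/(_ _ e0)[b [br Hb]] := g_ninfty.
  exists (Num.max a b); split; first exact: num_real.
  move=> x; rewrite gt_max => /andP[ax bx] y xy; split.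
    by apply: Ha; apply: lt_le_trans xy.
  by apply: Hb; apply: lt_le_trans xy.
exists t => // x /H[]; rewrite distrC sub0r normrN => /ltW ? /ltW ?; by split.
Qed.

(** A ridge of slope 0 is the constant [g t], nonzero once [g t] is within 1/2 of its limit 1. *)
Let S_cst c : S (fun=> c).
Proof.
have half0 : 0 < 2^-1 :> R by rewrite invr_gt0.
have [t t0 /(_ t (lexx t))[gt _]] := g_step half0.
have gn0 : g t != 0.
  by apply: contraTneq gt => ->; rewrite sub0r normrN normr1; lra.
have := S_linear (c / g t) 0 (S_ridge 0 t) (S_ridge 0 t).
by congr S; apply/funext => x; rewrite !mul0r add0r addr0 divfK.
Qed.

(* Adding one steep sigmoid per node of a grid of mesh [d] turns a good
   approximation of [h] left of a node into one left of the next node. *)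
Let staircase (d : R) (n : nat) : 0 < d -> - M + n%:R * d <= M ->
  forall eta : R, 0 < eta -> exists f, [/\ S f,
    forall x, `|phi x| <= M -> phi x <= - M + n%:R * d ->
      `|f x - h (phi x)| <= L * d * (C + 1) + eta
  & forall x, `|phi x| <= M -> - M + n%:R * d <= phi x ->
      `|f x - h (- M + n%:R * d)| <= eta].
Proof.
move=> d0; have Ld0 : 0 <= L * d by rewrite mulr_ge0// ltW.
elim: n => [|n IH] nM eta eta0.
  have E0 : 0 <= L * d * (C + 1) by rewrite mulr_ge0// addr_ge0.
  exists (fun=> h (- M)); split; first exact: S_cst.
    move=> x; rewrite mul0r addr0 ler_norml => /andP[Mx _] xM.
    have -> : phi x = - M by apply/eqP; rewrite eq_le xM.
    by rewrite subrr normr0 addr_ge0// ltW.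
  by move=> x _ _; rewrite mul0r addr0 subrr normr0 ltW.
move: nM; rewrite -natr1 mulrDl mul1r addrA => nM.
set s := - M + n%:R * d; rewrite -/s in nM IH *.
have nd0 : 0 <= n%:R * d by rewrite mulr_ge0// ltW.
have sM : s <= M by lra.
have s_abs : `|s| <= M by rewrite ler_norml sM andbT /s; lra.
have s'_abs : `|s + d| <= M by rewrite ler_norml nM andbT /s; lra.
pose D := h (s + d) - h s.
have Dd : `|D| <= L * d.
  by rewrite (le_trans (h_lipschitz s'_abs s_abs))// addrAC subrr add0r gtr0_norm.
(* Half of [eta] goes to the induction hypothesis, half to the new sigmoid, whose coefficient is
   [D]; the added 1 covers [D = 0]. *)
have D0 : 0 < 2 * (`|D| + 1) by have := normr_ge0 D; lra.
have eta2 : 0 < eta / 2 by rewrite divr_gt0.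
have [f [Sf fl fr]] := IH sM _ eta2.
have [t t0 Ht] := g_step (divr_gt0 eta0 D0).
have small r : `|r| <= eta / (2 * (`|D| + 1)) -> `|D * r| <= eta / 2.
  move=> rle; rewrite normrM (le_trans (ler_wpM2l _ rle))//.
  rewrite mulrA ler_pdivrMr//.
  have := ltW eta0; have := normr_ge0 D.
  have -> : eta / 2 * (2 * (`|D| + 1)) = `|D| * eta + eta by field.
  lra.
(* The sigmoid is centred at the midpoint of the cell from [s] to [s + d], whose ends become the
   arguments [-t] and [t]. *)
pose a := 2 * t / d; pose b := - (a * (s + d / 2)).
have a0 : 0 < a by rewrite /a divr_gt0// mulr_gt0.
have arg x : a * phi x + b = a * (phi x - (s + d / 2)) by rewrite /b; ring.
have adt : a * (d / 2) = t by rewrite /a; field; rewrite gt_eqF.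
exists (fun x => 1 * f x + D * g (a * phi x + b)); split; first exact: S_linear.
- move=> x xM xs; have [xs'|/ltW sx] := leP (phi x) s.
    have {fl} := fl x xM xs'.
    have /small : `|g (a * phi x + b)| <= eta / (2 * (`|D| + 1)).
      rewrite -[a * _ + b]opprK; apply: (Ht _ _).2.
      by rewrite arg -mulrN -adt ler_pM2l//; lra.
    move: (D * _) (L * d * _) => r E; rewrite !ler_norml mul1r; lra.
  (* Inside the new cell only boundedness of [g] is available: the jump costs [L * d * C] and the
     variation of [h] costs [L * d]. *)
  have := fr x xM sx.
  have : `|h (phi x) - h s| <= L * d.
    rewrite (le_trans (h_lipschitz xM s_abs))// ler_wpM2l// ger0_norm; lra.
  have : `|D * g (a * phi x + b)| <= L * d * C by rewrite normrM ler_pM.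
  rewrite mulrDr mulr1.
  move: (D * _) (L * d * _) => r E; rewrite !ler_norml mul1r; lra.
- move=> x xM xs.
  have sx : s <= phi x by lra.
  have := fr x xM sx.
  have /small : `|g (a * phi x + b) - 1| <= eta / (2 * (`|D| + 1)).
    by apply: (Ht _ _).1; rewrite arg -adt ler_pM2l//; lra.
  rewrite mulrBr mulr1.
  have -> : h (s + d) = h s + D by rewrite /D; ring.
  move: (D * _) => r; rewrite !ler_norml mul1r; lra.
Qed.

(** The last node of the staircase is [M] itself, so its left estimate covers the whole range of
    values; [n] is chosen to make [L * d * (C + 1)] less than [e / 2]. *)
Lemma sigmoid_approximable :
  approximable S [set x | `|phi x| <= M] (fun x => h (phi x)).
Proof.
move=> e e0.
pose B := L * (2 * M) * (C + 1).
have B0 : 0 <= B by rewrite /B !mulr_ge0 ?addr_ge0// ltW.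
pose n := Num.bound (2 * B / e).
have ne : 2 * B < n%:R * e.
  rewrite -ltr_pdivrMr//; apply: archi_boundP.
  by apply: divr_ge0; [exact: mulr_ge0|exact: ltW].
have n0 : 0 < n%:R :> R.
  rewrite lt_neqAle ler0n andbT eq_sym; apply: contraTneq ne => ->.
  by rewrite mul0r -leNgt mulr_ge0.
pose d := 2 * M / n%:R.
have d0 : 0 < d by rewrite divr_gt0// mulr_gt0.
have nd : - M + n%:R * d = M by rewrite /d; field; rewrite gt_eqF.
have nM : - M + n%:R * d <= M by rewrite nd.
have e4 : 0 < e / 4 by rewrite divr_gt0.
have [f [Sf fl _]] := staircase d0 nM e4.
exists f => // x xM; rewrite distrC.
apply: le_lt_trans (fl x xM _) _.
  by rewrite nd (le_trans (ler_norm _)).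
have -> : L * d * (C + 1) = B / n%:R by rewrite /B /d; field; rewrite gt_eqF.
have : B / n%:R < e / 2
  by rewrite ltr_pdivrMr// mulrAC ltr_pdivlMr// mulrC [e * _]mulrC.
lra.
Qed.

End Sigmoid.

(** * The Hahn-Banach theorem for a seminorm *)

Section HahnBanach.
Context (R : realType) (V : lmodType R) (p : V -> R).
Hypothesis pD : forall x y, p (x + y) <= p x + p y.
Hypothesis pZ : forall (a : R) x, p (a *: x) = `|a| * p x.

Let p0 : p 0 = 0. Proof. by rewrite -(scale0r 0) pZ normr0 mul0r. Qed.
Let pN x : p (- x) = p x. Proof. by rewrite -scaleN1r pZ normrN1 mul1r. Qed.
Let p_ge0 x : 0 <= p x.
Proof. by have := pD x (- x); rewrite subrr p0 pN; lra. Qed.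

(* Partial linear functionals dominated by [p] are represented by their graphs,
   so that Zorn's lemma for inclusion applies; domination makes such a graph
   single-valued. *)
Let dominated (G : set (V * R)) :=
  (forall a u v, G u -> G v -> G (a *: u.1 + v.1, a * u.2 + v.2)) /\
  (forall u, G u -> u.2 <= p u.1).

Let dominated_fun G x r s : dominated G -> G (x, r) -> G (x, s) -> r = s.
Proof.
move=> [GL Gp] Gr Gs.
have le a b : G (x, a) -> G (x, b) -> a <= b.
  move=> Ga Gb; have /Gp /= := GL (-1) _ _ Gb Ga.
  by rewrite scaleN1r addNr p0; lra.
by apply/eqP; rewrite eq_le !le.
Qed.

(** Domination asks the value [c] at [x] to lie above every [v.2 - p (v.1 - x)] and below every
    [p (v.1 + x) - v.2]. Subadditivity puts the former below the latter, so their supremum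
    serves. *)
Let dominated_extend G x : dominated G -> G (0, 0) ->
  exists H, [/\ dominated H, G `<=` H & exists r, H (x, r)].
Proof.
move=> [GL Gp] G0.
pose E := [set u.2 - p (u.1 - x) | u in G].
have Eub v : G v -> ubound E (p (v.1 + x) - v.2).
  move=> Gv _ [u Gu <-]; have := Gp _ (GL 1 _ _ Gu Gv) => /=.
  rewrite scale1r mul1r => uv.
  have := pD (u.1 - x) (v.1 + x); rewrite addrACA addNr addr0; lra.
have E0 : E !=set0 by exists (0 - p (0 - x)), (0, 0).
have Esup : has_sup E by split=> //; exists (p (0 + x) - 0); exact: Eub G0.
pose c := sup E.
have c_ge v : G v -> v.2 - p (v.1 - x) <= c.
  by move=> Gv; apply: ub_le_sup => //; [exact: Esup.2|exists v].
have c_le v : G v -> c <= p (v.1 + x) - v.2.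
  by move=> Gv; apply: ge_sup => //; exact: Eub.
exists [set w | exists2 u, G u & exists t, w = (u.1 + t *: x, u.2 + t * c)].
split; last 1 first.
- by exists c, (0, 0) => //; exists 1; rewrite scale1r mul1r !add0r.
- split.
    move=> a _ _ [u Gu [t ->]] [v Gv [s ->]] /=.
    exists (a *: u.1 + v.1, a * u.2 + v.2); first exact: GL.
    exists (a * t + s); congr (_, _) => /=; last by ring.
    by rewrite scalerDr scalerA scalerDl addrACA.
  move=> _ [u Gu [t ->]] /=.
  have GZ a : G (a *: u.1, a * u.2).
    by have := GL a _ _ Gu G0; rewrite /= !addr0.
  have [->|tn0] := eqVneq t 0.
    by rewrite scale0r mul0r !addr0; exact: Gp.
  have at0 : 0 < `|t| by rewrite normr_gt0.
  have tK : `|t| * `|t|^-1 = 1 by rewrite divff// gt_eqF.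
  (* Homogeneity reduces the coefficient of [x] to 1 or -1, the cases of [c_le] and [c_ge]. *)
  have -> : u.1 + t *: x = `|t| *: (`|t|^-1 *: u.1 + (t / `|t|) *: x).
    by rewrite scalerDr !scalerA tK scale1r mulrCA tK mulr1.
  have -> : u.2 + t * c = `|t| * (`|t|^-1 * u.2 + t / `|t| * c).
    by rewrite mulrDr !mulrA tK mul1r [`|t| * t]mulrC
      -[t * `|t| / _]mulrA tK mulr1.
  rewrite pZ normr_id ler_wpM2l//.
  have [tp|tn] := ltP 0 t.
    rewrite gtr0_norm// divff// scale1r mul1r.
    by have /= := c_le _ (GZ t^-1); lra.
  rewrite ler0_norm// invrN mulrN divff// scaleN1r mulN1r.
  by have /= := c_ge _ (GZ (- t^-1)); lra.
- move=> u Gu; exists u => //; exists 0.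
  by rewrite scale0r mul0r !addr0; case: u {Gu}.
Qed.

Lemma hahn_banach_seminorm (x0 : V) :
  exists l : {linear V -> R^o}, l x0 = p x0 /\ forall x, `|l x| <= p x.
Proof.
(* The condition at [x0] is imposed on nonempty graphs only, since the union of the empty chain is
   empty. *)
pose P := [set G | dominated G /\ (G !=set0 -> G (x0, p x0))].
have [F FP Ftot|A [[Adom Ax0] Amax]] := @Zorn_bigcup _ P.
  split; [split|].
  - move=> a u v [G FG Gu] [H FH Hv].
    have [GH|HG] := Ftot _ _ FG FH.
      by exists H => //; apply: (FP _ FH).1.1 => //; exact: GH.
    by exists G => //; apply: (FP _ FG).1.1 => //; exact: HG.
  - by move=> u [G FG Gu]; exact: (FP _ FG).1.2.
  - by move=> [u [G FG Gu]]; exists G => //; apply: (FP _ FG).2; exists u.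
have An0 : A !=set0.
  apply: contrapT => An0.
  (* An empty graph is not maximal: the functional on the line through [x0] enlarges it. *)
  apply: (Amax [set w | exists t : R, w = (t *: x0, t * p x0)]).
    split; first by move=> u Au; case: An0; exists u.
    move=> /(_ (0, 0)) H; apply: An0; exists (0, 0); apply: H.
    by exists 0; rewrite scale0r mul0r.
  split; last by move=> _; exists 1; rewrite scale1r mul1r.
  split.
    move=> a _ _ [t ->] [s ->] /=; exists (a * t + s).
    by rewrite scalerA -scalerDl mulrA -mulrDl.
  by move=> _ [t ->] /=; rewrite pZ ler_wpM2r// ler_norm.
have {}Ax0 := Ax0 An0.
have A0 : A (0, 0).
  have := Adom.1 (-1) _ _ Ax0 Ax0.
  by rewrite /= scaleN1r mulN1r !addNr.
have Atot x : exists r, A (x, r).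
  have [H [Hdom AH [r Hxr]]] := dominated_extend x Adom A0.
  exists r; apply: contrapT => nA; apply: (Amax H).
    by split=> // HA; apply: nA; exact: HA.
  by split=> // _; exact: AH.
have [l lA] := choice Atot.
have l_lin : linear (l : V -> R^o).
  by move=> a x y; apply: (dominated_fun Adom (lA _));
    exact: Adom.1 (lA x) (lA y).
pose L : {linear V -> R^o} := HB.pack (l : V -> R^o)
  (GRing.isLinear.Build R V R^o *:%R l l_lin).
exists L; split; first exact: dominated_fun Adom (lA _) Ax0.
have lp x : l x <= p x := Adom.2 _ (lA x).
move=> x; rewrite ler_norml lp andbT lerNl -pN.
by rewrite -(linearN L) /=; exact: lp.
Qed.

End HahnBanach.

(** * Linear spans *)

Section LinSpan.
Context (R : realType) (V : lmodType R).
Implicit Types S P : set V.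

Lemma lin_span_sub S : S `<=` lin_span S.
Proof.
move=> v Sv; exists 1%N, (fun=> 1), (fun=> v); split=> //.
by rewrite big_ord1 scale1r.
Qed.

Lemma lin_span0 S : lin_span S 0.
Proof. by exists 0%N, (fun=> 0), (fun=> 0); split=> [[]|]; rewrite ?big_ord0. Qed.

Lemma lin_span_ind S P : P 0 ->
  (forall (a b : R) u v, P u -> P v -> P (a *: u + b *: v)) -> S `<=` P ->
  lin_span S `<=` P.
Proof.
move=> P0 PL SP _ [m [c [s [Ss ->]]]].
apply: (big_ind P) => // [u v Pu Pv|i _].
  by rewrite -[u]scale1r -[v]scale1r; exact: PL.
by rewrite -[_ *: _]addr0 -[0](scaler0 _ 0); apply: PL => //; exact: SP.
Qed.

Lemma lin_span_linear S (a b : R) u v :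
  lin_span S u -> lin_span S v -> lin_span S (a *: u + b *: v).
Proof.
move=> [m [c [s [Ss ->]]]] [k [d [t [St ->]]]].
exists (m + k)%N,
  (fun i => match fintype.split i with inl i => a * c i | inr j => b * d j end),
  (fun i => match fintype.split i with inl i => s i | inr j => t j end).
split=> [i|]; first by case: fintype.split.
rewrite big_split_ord !scaler_sumr; congr (_ + _); apply: eq_bigr => i _.
  by rewrite (unsplitK (inl _ i)) scalerA.
by rewrite (unsplitK (inr _ i)) scalerA.
Qed.

End LinSpan.

Lemma lin_span_linear_subspace (R : realType) (T : choiceType)
  (S : set (T -> R^o)) : linear_subspace (lin_span S).
Proof. by move=> a b f g; exact: lin_span_linear. Qed.

(** By bilinearity: induction on [f] with [g] fixed, then on [g] with a generator as the other
    factor. *)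
Lemma lin_span_mul (R : realType) (T : choiceType) (S : set (T -> R^o)) :
  (forall f g, S f -> S g -> S (fun x => f x * g x)) ->
  forall f g, lin_span S f -> lin_span S g -> lin_span S (fun x => f x * g x).
Proof.
move=> SM f g Sf Sg; have S0 : lin_span S (fun=> 0).
  exact: lin_span0.
pose P (h : T -> R^o) := lin_span S (fun x => h x * g x).
suff : lin_span S `<=` P by apply.
apply: lin_span_ind => [|a b u v Pu Pv|u Su]; rewrite /P.
- by move: S0; congr lin_span; apply/funext => x; rewrite mul0r.
- have := lin_span_linear a b Pu Pv; congr lin_span; apply/funext => x.
  by rewrite mulrDl -!scalerAl.
- pose Q (h : T -> R^o) := lin_span S (fun x => u x * h x).
  suff : lin_span S `<=` Q by apply.
  apply: lin_span_ind => [|a b f' g' Qf Qg|f' Sf']; rewrite /Q.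
  + by move: S0; congr lin_span; apply/funext => x; rewrite mulr0.
  + have := lin_span_linear a b Qf Qg; congr lin_span; apply/funext => x.
    by rewrite mulrDr -!scalerAr.
  + exact/lin_span_sub/SM.
Qed.

Lemma lin_span_approximable (R : realType) (T : choiceType)
  (S S' : set (T -> R^o)) (K : set T) :
  (forall f, S f -> approximable (lin_span S') K f) ->
  forall f, lin_span S f -> approximable (lin_span S') K f.
Proof.
move=> SS'; apply: lin_span_ind => //; first exact/approximable_id/lin_span0.
by move=> a b f g; apply: approximable_linear; exact: lin_span_linear_subspace.
Qed.

Lemma lin_span_continuous (R : realType) (T : topologicalType)
  (S : set (T -> R^o)) : (forall f, S f -> continuous f) ->
  forall f, lin_span S f -> continuous f.
Proof.
move=> Sc; apply: lin_span_ind => //; first by move=> x; exact: cvg_cst.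
move=> a b g h cg ch x.
by apply: cvgD; apply: cvgZl_tmp; [exact: cg|exact: ch].
Qed.

(** * Continuous functionals on a Fréchet space *)

Section Frechet.
Context (R : realType) (X : topologicalLmodType R) (p : nat -> X -> R).
Hypothesis Xp : frechet p.

Lemma seminorm_continuous (l : {linear X -> R^o}) (k : nat) :
  (forall x, `|l x| <= p k x) -> continuous l.
Proof.
move=> lp x; apply/cvgrPdist_lt => e e0.
apply/(frechet_topology Xp); exists k, e; split=> // y /(_ k (leqnn k)) py.
by rewrite /= distrC -linearB (le_lt_trans (lp _)).
Qed.

(** If every seminorm vanished on the difference, each neighbourhood of [x] would contain [y],
    against the Hausdorff property. *)
Lemma seminorm_separates (x y : X) : x <> y -> exists k, p k (x - y) != 0.
Proof.
move=> xy; apply: contrapT => /forallNP H; apply: xy.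
have pz k : p k (y - x) = 0.
  rewrite -opprB -scaleN1r (frechet_seminorm Xp k).2.
  by move: (H k) => /negP; rewrite negbK => /eqP ->; rewrite mulr0.
apply: (frechet_hausdorff Xp) => A B /(frechet_topology Xp)[n [e [e0 nA]]] Bx.
by exists y; split; [apply: nA => k _; rewrite pz|exact: nbhs_singleton].
Qed.

(** Hahn-Banach for a seminorm separating the points. The domination is kept in order to bound [l]
    on the range of [sigma]. *)
Lemma dual_separates (x y : X) : x <> y ->
  exists (l : {linear X -> R^o}) (k : nat),
    [/\ continuous l, forall z, `|l z| <= p k z & l (x - y) != 0].
Proof.
move=> /seminorm_separates[k pxy]; have [pD pZ] := frechet_seminorm Xp k.
have [l [lxy lp]] := hahn_banach_seminorm pD pZ (x - y).
by exists l, k; split=> //; [exact: seminorm_continuous lp|rewrite lxy].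
Qed.

End Frechet.

(** * Construction and continuity of networks *)

Section Networks.
Context (R : realType) (X : topologicalLmodType R) (sigma : X -> X).

Lemma rank_one_linear (m : {linear X -> R^o}) (w : X) : continuous m ->
  exists2 B : {linear X -> X}, continuous B & forall y, B y = m y *: w.
Proof.
move=> cm; pose B y := m y *: w.
have Blin : linear B by move=> a y z; rewrite /B linearP scalerDl scalerA.
exists (HB.pack B (GRing.isLinear.Build R X X *:%R B Blin) : {linear X -> X})
  => //.
move=> y; apply: (@continuous2_cvg _ _ _ _ _ _ m (fun=> w) (fun a z => a *: z)).
- exact: (@scale_continuous R X (m y, w)).
- exact: cm.
- exact: cvg_cst.
Qed.

(** Treating functionals as networks without layers lets depth one use the same composition step as
    greater depths. *)
Lemma networks0 (l : {linear X -> R^o}) : continuous l -> networks 0 sigma l.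
Proof.
move=> cl; exists l, (fun=> idfun), (fun=> 0); split=> //.
  by case.
by apply/funext => x; rewrite /network big_ord0.
Qed.

(** If [m] is the output functional of [f], the new layer has linear part [y |-> m y *: w], which
    sends the output of the inner layers to [f x *: w]. *)
Lemma networks_ridge n f (l : {linear X -> R^o}) (w c : X) : networks n sigma f ->
  continuous l -> networks n.+1 sigma (fun x => l (sigma (f x *: w + c))).
Proof.
move=> [m [A [b [cm cA ->]]]] cl; have [B cB BE] := rank_one_linear w cm.
(* Index 0 is the outermost layer, so the new layer takes it and the old ones shift by one. *)
exists l, (fun i => if unlift ord0 i is Some j then A j else B),
  (fun i => if unlift ord0 i is Some j then b j else c); split=> //.
  by move=> i; case: unliftP.
apply/funext => x; rewrite /network big_ord_recl /= unlift_none /affine /= BE.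
by under [in RHS]eq_bigr do rewrite liftK.
Qed.

Lemma networks_continuous n f : continuous sigma -> networks n sigma f ->
  continuous f.
Proof.
move=> cs [l [A [b [cl cA ->]]]] x; apply: continuous_comp; last exact: cl.
move: x; apply: (big_ind (fun g : X -> X => continuous g)).
- by move=> x; exact: cvg_id.
- by move=> g h cg ch x; apply: continuous_comp; [exact: ch|exact: cg].
- move=> i _ x; apply: continuous_comp; last exact: cs.
  apply: (@continuous2_cvg _ _ _ _ _ _ (A i) (fun=> b i) (fun y z => y + z)).
  + exact: (@add_continuous X (A i x, b i)).
  + exact: cA.
  + exact: cvg_cst.
Qed.

End Networks.

(** * Density on each compact set *)

Section Density.
Context (R : realType) (X : topologicalLmodType R) (p : nat -> X -> R).
Context (sigma : X -> X) (psi : {linear X -> R^o}) (u : X).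
Hypothesis Xp : frechet p.
Hypothesis sigma_cont : continuous sigma.
Hypothesis sigma_bounded : von_neumann_bounded p sigma.
Hypotheses (psi_neq0 : (psi : X -> R^o) <> 0) (u_neq0 : u <> 0).
Hypothesis sigma_pos :
  forall x, psi x > 0 -> sigma (lambda *: x) @[lambda --> +oo] --> u.
Hypothesis sigma_neg :
  forall x, psi x < 0 -> sigma (lambda *: x) @[lambda --> +oo] --> 0.

(** A functional nonzero at [u], dominated by one seminorm and normalised to 1 at [u], is read along
    a ray on which [psi] is positive. *)
Lemma network_sigmoid : exists (l : {linear X -> R^o}) (v : X) (C : R),
  [/\ continuous l, 0 <= C, forall x, `|l (sigma x)| <= C,
      l (sigma (s *: v)) @[s --> +oo] --> (1 : R)
    & l (sigma ((- s) *: v)) @[s --> +oo] --> (0 : R)].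
Proof.
have [v psiv] : exists v, 0 < psi v.
  have [w pw] : exists w, psi w != 0.
    apply: contrapT => /forallNP H; apply: psi_neq0; apply/funext => x.
    by have /negP := H x; rewrite negbK => /eqP.
  (* This choice makes [psi] equal to the square of [psi w], whatever the sign of [psi w]. *)
  exists (psi w *: w); rewrite linearZ /=.
  by rewrite -[_ *: _]/(psi w * psi w) -expr2 lt_neqAle eq_sym expf_neq0 ?sqr_ge0.
have [m [k [cm mp]]] := dual_separates Xp u_neq0; rewrite subr0 => mu.
have [c [c0 pc]] := sigma_bounded k.
pose l : {linear X -> R^o} := (m u)^-1 \*: m.
have cl : continuous l by move=> x; apply: cvgZl_tmp; exact: cm.
have lu : l u = 1 by exact: mulVf.
exists l, v, (`|(m u)^-1| * c); split=> //.
- by rewrite mulr_ge0// ltW.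
- by move=> x; rewrite /l /= normrM ler_wpM2l// (le_trans (mp _)).
- by rewrite -lu; apply: continuous_cvg; [exact: cl|exact: sigma_pos].
- rewrite -(linear0 l); apply: continuous_cvg; first exact: cl.
  under eq_fun do rewrite scaleNr -scalerN.
  by apply: sigma_neg; rewrite linearN oppr_lt0.
Qed.

(** The bound of [f] on [K] selects the Lipschitz constant, and [g (a * f x + b)] is a network one
    layer deeper because its argument of [sigma] is [f x *: (a *: v) + b *: v]. *)
Lemma networks_comp_approximable n f (h : R -> R) (K : set X) : compact K ->
  networks n sigma f ->
  (forall M : R, 0 < M -> exists2 L : R, 0 <= L & forall s t,
     `|s| <= M -> `|t| <= M -> `|h s - h t| <= L * `|s - t|) ->
  approximable (lin_span (networks n.+1 sigma)) K (fun x => h (f x)).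
Proof.
move=> cK nf hlip.
have cf := networks_continuous sigma_cont nf.
have [M M0 fM] := compact_continuous_bounded cK cf.
have [L L0 hL] := hlip M M0.
have [l [v [C [cl C0 lC l1 l0]]]] := network_sigmoid.
pose g (s : R) : R := l (sigma (s *: v)).
have ridge a b : lin_span (networks n.+1 sigma) (fun x => g (a * f x + b)).
  apply: lin_span_sub.
  have := networks_ridge (a *: v) (b *: v) nf cl.
  by congr networks; apply/funext => x; rewrite /g scalerDl mulrC scalerA.
have gC x : `|g x| <= C by exact: lC.
move=> e e0.
have [s Ss sfe] := sigmoid_approximable (@lin_span_linear_subspace _ _ _) ridge
  l1 l0 gC hL C0 L0 M0 e0.
by exists s => // x Kx; apply: sfe; exact: fM.
Qed.

Lemma networks_dense_on_compact n (K : set X) (f : X -> R^o) : compact K ->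
  continuous f -> approximable (lin_span (networks n.+1 sigma)) K f.
Proof.
move=> cK cf; elim: n => [|n IH]; last first.
  apply: approximable_trans IH; apply: lin_span_approximable => g ng.
  apply: (@networks_comp_approximable _ g id) => // M _.
  by exists 1 => // s t _ _; rewrite mul1r.
(* Exponentials of functionals are closed under products, contain 1 as the exponential of 0, and
   separate points by injectivity of the exponential. *)
pose E := [set f : X -> R^o |
  exists2 l : {linear X -> R^o}, continuous l & f = fun x => expR (l x)].
have EM g h : E g -> E h -> E (fun x => g x * h x).
  move=> [l cl ->] [m cm ->]; exists (l \+ m).
    by move=> x; apply: cvgD; [exact: cl|exact: cm].
  by apply/funext => x; rewrite -expRD.
apply: (@approximable_trans _ _ (lin_span E)).
  apply: lin_span_approximable => _ [l cl ->].
  apply: (networks_comp_approximable cK (networks0 _ cl)) => M M0.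
  exists (expR M); first exact: expR_ge0.
  move=> s t sM tM; apply: expR_lipschitz.
    exact: le_trans (ler_norm _) sM.
  exact: le_trans (ler_norm _) tM.
apply: stone_weierstrass => //.
- apply: lin_span_continuous => _ [l cl ->] x.
  by apply: continuous_comp; [exact: cl|exact: continuous_expR].
- exact: lin_span_linear_subspace.
- exact: lin_span_mul.
- apply: lin_span_sub; exists \0; first by move=> x; exact: cvg_cst.
  by apply/funext => x; rewrite expR0.
- move=> x y _ _ xy; have [l [k [cl _ lxy]]] := dual_separates Xp xy.
  exists (fun z => expR (l z)); first by apply: lin_span_sub; exists l.
  move=> /expR_inj lE; move: lxy; rewrite linearB /= lE subrr.
  by rewrite eqxx.
Qed.

End Density.

(** * From compact sets to the topology of compact convergence *)

Lemma compact_approximable_dense (R : realType) (X : topologicalLmodType R)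
    (n : nat) (sigma : X -> X) : continuous sigma ->
  (forall (K : set X) (f : X -> R^o), compact K -> continuous f ->
    approximable (lin_span (networks n sigma)) K f) ->
  dense (network_span n sigma).
Proof.
move=> cs approx O [f Of] [B oB BO].
have span_cont := lin_span_continuous (fun g => @networks_continuous _ _ _ n g cs).
(* The filter of uniform closeness to [f] on compact sets; its convergence to [f] puts one of its
   basic sets inside the open set [B]. *)
pose F : set_system (X -> R^o) := [set A | exists2 K : set X, compact K &
  exists2 e : R, 0 < e & forall g, (forall x, K x -> `|f x - g x| < e) -> A g].
have FF : Filter F.
  split.
  - by exists set0; [exact: compact0|exists 1].
  - move=> A C [K cK [e e0 KA]] [K' cK' [e' e0' KC]].
    exists (K `|` K'); first exact: compactU.
    exists (Num.min e e'); first by rewrite lt_min e0.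
    move=> g Hg; split; [apply: KA => x Kx|apply: KC => x Kx].
      by have := Hg x (or_introl Kx); rewrite lt_min => /andP[].
    by have := Hg x (or_intror Kx); rewrite lt_min => /andP[].
  - move=> A C AC [K cK [e e0 KA]]; exists K => //; exists e => // g Hg.
    exact/AC/KA.
have Ff : F --> ((f : X -> R^o) : {family compact, X -> R^o}).
  apply/fam_cvgP => K cK P /uniform_nbhs[E [entE EP]].
  move: entE; rewrite -entourage_ballE => -[e /= e0 eE].
  by exists K => //; exists e => // g Hg; apply: EP => y Ky; apply: eE; exact: Hg.
have [|K cK [e e0 KB]] := Ff B.
  by apply: open_nbhs_nbhs; split=> //; rewrite -BO in Of.
have [g Sg fg] := approx K f cK (@cts_fun _ _ f) e e0.
(* The approximant is a bare function; continuity of networks makes it a point of the space. *)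
pose G : continuousType X R^o := HB.pack g
  (isContinuous.Build X R^o g (span_cont g Sg)).
exists G; split; last exact: Sg.
by rewrite -BO; apply: KB.
Qed.

Unset Implicit Arguments.

Theorem proposition5p2 (n : nat) (hn : (1 < n)%N)
    (R : realType) (X : topologicalLmodType R) (p : nat -> X -> R)
    (X_frechet : frechet p) (X_separable : separable X)
    (sigma : X -> X) (sigma_cont : continuous sigma)
    (sigma_bounded : von_neumann_bounded p sigma)
    (sigma_separating :
      exists (psi : {linear X -> R^o}) (u : X),
        [/\ continuous psi, (psi : X -> R^o) <> 0 & u <> 0] /\
        [/\ forall x, psi x > 0 -> sigma (lambda *: x) @[lambda --> +oo] --> u,
            forall x, psi x < 0 -> sigma (lambda *: x) @[lambda --> +oo] --> 0
          & forall x, psi x = 0 -> sigma (lambda *: x) @[lambda --> +oo] --> 0]) :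
  dense (network_span n sigma).
Proof.
case: n hn => [//|n] _.
have [psi [u [[_ psi0 u0] [pos neg _]]]] := sigma_separating.
apply: compact_approximable_dense => // K f.
exact: (networks_dense_on_compact X_frechet sigma_cont sigma_bounded
  psi0 u0 pos neg).
Qed.
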